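(* Let $G$ be a countable infinite discrete group acting by homeomorphisms on a compact Hausdorff space $X$, and suppose that the action $G\curvearrowright X$ is topologically free. Then the following are equivalent: (1) There are no proper closed ideals in $\ell^1(G\curvearrowright X)$. (2) There are no proper closed and self-adjoint ideals in $\ell^1(G\curvearrowright X)$. (3) The action $G\curvearrowright X$ is minimal. Here a proper ideal means an ideal different from $\{0\}$ and from the whole algebra.
   Context: Write $\sigma_s:X\to X$ for the homeomorphism given by $s\in G$, $e$ for the identity of $G$, and $C(X)$ for the continuous functions $X\to\mathbb{C}$ with the supremum norm $\|\cdot\|_\infty$. Set $\alpha_s(f)(x)=f(\sigma_s^{-1}(x))$ for $s\in G$, $f\in C(X)$, $x\in X$. $\ell^1(G\curvearrowright X)$ is the Banach $*$-algebra of all functions $f:G\to C(X)$ with $\|f\|=\sum_{s\in G}\|f(s)\|_\infty<\infty$, with pointwise linear operations, product $(fg)(s)=\sum_{t\in G}f(t)\,\alpha_t(g(t^{-1}s))$ and involution $(f^* )(s)=\alpha_s(\overline{f(s^{-1})})$. ''Ideal'' means two-sided ideal. An ideal $I$ is self-adjoint if $f^*\in I$ for every $f\in I$. The action is topologically free if the set $\{x\in X:\sigma_s(x)\neq x\text{ for all }s\in G\setminus\{e\}\}$ is dense in $X$. The action is minimal if the only closed $G$-invariant subsets of $X$ are $\emptyset$ and $X$; equivalently, the orbit of every point of $X$ is dense in $X$. *)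

(* Defs.v *)
From HB Require Import structures.
From mathcomp Require Import all_boot all_order all_algebra finmap.
From mathcomp Require Import all_classical all_reals all_analysis.
From mathcomp Require Import complex ring lra.
From mathcomp.analysis.showcase Require summability.
Set Implicit Arguments.
Unset Strict Implicit.
Unset Printing Implicit Defensive.
Import Order.TTheory GRing.Theory Num.Theory.
Import numFieldNormedType.Exports.
Local Open Scope classical_set_scope.
Local Open Scope ring_scope.
Local Open Scope complex_scope.

(* The normed space structure of C = R[i] over itself; real-closed only provides
   the field, the order and the norm. *)
HB.instance Definition _ (R : realType) := NormedModule.copy R[i] R[i]^o.

Section complex_completeness.
Variable R : realType.
Implicit Types z w : R[i].

Local Notation normc := (@ComplexField.Normc.normc R).

Lemma normrcE z : `|z| = (normc z)%:C.
Proof. by rewrite normc_def; case: z. Qed.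

Lemma normc_ge0 z : 0 <= normc z.
Proof. by rewrite -lecR -normrcE normr_ge0. Qed.

Lemma normc_ReIm z : normc z <= `|complex.Re z| + `|complex.Im z|.
Proof.
case: z => a b /=.
rewrite -(@ler_pXn2r _ 2) ?nnegrE ?sqrtr_ge0 ?addr_ge0//.
rewrite sqr_sqrtr ?addr_ge0 ?sqr_ge0// sqrrD !real_normK ?num_real//.
by rewrite lerD2r lerDl mulrn_wge0// mulr_ge0.
Qed.

Lemma normc_ge_Im z : `|complex.Im z| <= normc z.
Proof. by case: z => a b /=; rewrite -sqrtr_sqr ler_wsqrtr// lerDr sqr_ge0. Qed.

Lemma normc_continuous : continuous normc.
Proof.
move=> z; apply/(@cvgrPdist_lt R R R[i] (nbhs z) (nbhs_filter z)) => e e0.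
have /nbhs_ballP [r /= r0 rz] : nbhs z (ball z e%:C).
  by apply: nbhsx_ballx; rewrite ltcR.
apply/nbhs_ballP; exists r => //= w /rz; rewrite -ball_normE /= normrcE ltcR.
apply: le_lt_trans.
have := ler_dist_dist z w; rewrite !normrcE -rmorphB lecE /= => /andP[_].
by rewrite expr0n /= addr0 sqrtr_sqr.
Qed.

Lemma complex_pos (e : R[i]) : 0 < e -> exists2 r : R, 0 < r & e = r%:C.
Proof.
by case: e => x y; rewrite ltcE /= => /andP[/eqP -> x0]; exists x.
Qed.

Lemma complex_complete (F : set_system R[i]) :
  ProperFilter F -> cauchy F -> cvg F.
Proof.
move=> FF /cauchy_ballP F_cauchy.
have cvg_part (p : R[i] -> R) : {morph p : z w / z - w} ->
    (forall z, `|p z| <= normc z) -> cvg (p z @[z --> F]).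
  move=> pB p_lip; suff p_cauchy : cauchy (p z @[z --> F]).
    exact: (@cauchy_cvg R (p z @[z --> F]) _ p_cauchy).
  apply/cauchy_ballP => e e0.
  have /F_cauchy : 0 < e%:C by rewrite ltcR.
  rewrite !near2E /= => -[[A B] /= [FA FB] AB].
  exists (p @` A, p @` B) => /=.
    by split; [apply: filterS FA | apply: filterS FB] => z ?; exists z.
  move=> [x y] [/= [z Az <-] [w Bw <-]]; rewrite /ball /= -pB.
  have := AB (z, w) (conj Az Bw); rewrite -ball_normE /= normrcE ltcR.
  exact/le_lt_trans/p_lip.
have Re_cvg : cvg (complex.Re z @[z --> F]).
  by apply: cvg_part => [[? ?] [? ?]//|z]; rewrite -lecR -normrcE normc_ge_Re.
have Im_cvg : cvg (complex.Im z @[z --> F]).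
  by apply: cvg_part => [[? ?] [? ?]//|z]; exact: normc_ge_Im.
apply/cvg_ex; exists (lim (complex.Re z @[z --> F]) +i* lim (complex.Im z @[z --> F])).
apply/cvgrPdist_lt => e /complex_pos[r r0 ->].
have r20 : 0 < r / 2 by rewrite divr_gt0.
move/cvgrPdist_lt : Re_cvg => /(_ _ r20) Re_near.
move/cvgrPdist_lt : Im_cvg => /(_ _ r20) Im_near.
apply: filterS2 Re_near Im_near => -[x y] /= hx hy.
rewrite normrcE ltcR (le_lt_trans (normc_ReIm _))//.
by rewrite [ltRHS]splitr ltrD.
Qed.

HB.instance Definition _ := Uniform_isComplete.Build R[i] complex_complete.

End complex_completeness.

HB.mixin Record isCompactHausdorff (X : Type) of Topological X := {
  compactHausdorff_compact : compact [set: X] ;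
  compactHausdorff_hausdorff : hausdorff_space X
}.

#[short(type="compactHausdorffType")]
HB.structure Definition CompactHausdorff :=
  {X of isCompactHausdorff X & Topological X}.

Section continuous_functions.
Variables (R : realType) (X : compactHausdorffType).

Definition continuous_pred : {pred X -> R[i]} :=
  [pred f | `[< continuous (f : X -> R[i]) >]].

(* contFun R X is the space C(X), a normed space for the supremum norm. *)
Record contFun := ContFun {
  contFun_val :> X -> R[i] ;
  contFun_in : contFun_val \in continuous_pred
}.

HB.instance Definition _ := [isSub for contFun_val].
HB.instance Definition _ := [Choice of contFun by <:].

Implicit Types f g : contFun.

Lemma contFun_continuous f : continuous f.
Proof. by case: f => f /= /asboolP. Qed.

Lemma contFunP f g : f =1 g -> f = g.
Proof. by move=> fg; apply/val_inj/funext. Qed.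

Fact continuous_subring : GRing.subring_closed continuous_pred.
Proof.
split=> [|f g /asboolP f_cts /asboolP g_cts|f g /asboolP f_cts /asboolP g_cts].
- by apply/asboolP => x; exact: cvg_cst.
- by apply/asboolP => x; apply: cvgB; [exact: f_cts|exact: g_cts].
- by apply/asboolP => x; apply: cvgM; [exact: f_cts|exact: g_cts].
Qed.

HB.instance Definition _ :=
  GRing.SubChoice_isSubComPzRing.Build (X -> R[i])%type continuous_pred contFun
    continuous_subring.

Fact continuous_submod : GRing.subsemimod_closed continuous_pred.
Proof.
split; first by split=> [|f g /asboolP f_cts /asboolP g_cts]; apply/asboolP => x;
  [exact: cvg_cst | apply: cvgD; [exact: f_cts|exact: g_cts]].
move=> a f /asboolP f_cts; apply/asboolP => x; apply: cvgZr; exact: f_cts.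
Qed.

HB.instance Definition _ :=
  GRing.SubZmodule_isSubLmodule.Build R[i] (X -> R[i])%type continuous_pred contFun
    continuous_submod.

Local Notation normc := (@ComplexField.Normc.normc R).

(* X may be empty: sup set0 = 0. *)
Definition supnorm f : R := sup (range (normc \o f)).

Lemma contFun_bounded f : has_ubound (range (normc \o f)).
Proof.
have : compact ((normc \o f) @` [set: X]).
  apply: continuous_compact; last exact: compactHausdorff_compact.
  apply/continuous_subspaceT => x; apply: continuous_comp.
    exact: contFun_continuous.
  exact: normc_continuous.
move=> /compact_bounded [M [_ /(_ (M + 1))]].
rewrite ltrDl ltr01 => /(_ isT) f_le; exists (M + 1) => y fy.
exact: le_trans (ler_norm _) (f_le _ fy).
Qed.

Lemma normc_supnorm f x : normc (f x) <= supnorm f.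
Proof. by apply: sup_ubound; [exact: contFun_bounded|exists x]. Qed.

Lemma supnorm_le f (M : R) : 0 <= M -> (forall x, normc (f x) <= M) ->
  supnorm f <= M.
Proof.
move=> M0 f_le; rewrite /supnorm.
have [->|/set0P ne0] := eqVneq (range (normc \o f)) set0; first by rewrite sup0.
by apply: ge_sup => // _ [x _ <-]; exact: f_le.
Qed.

Lemma supnorm_ge0 f : 0 <= supnorm f.
Proof.
rewrite /supnorm.
have [->|/set0P[_ [x _ _]]] := eqVneq (range (normc \o f)) set0.
  by rewrite sup0.
exact: le_trans (normc_ge0 _) (normc_supnorm f x).
Qed.

Fact supnormD f g : (supnorm (f + g))%:C <= (supnorm f)%:C + (supnorm g)%:C.
Proof.
rewrite -rmorphD lecR; apply: supnorm_le => [|x].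
  by rewrite addr_ge0// supnorm_ge0.
rewrite -lecR -normrcE rmorphD (le_trans (ler_normD _ _))// !normrcE -!rmorphD lecR.
by rewrite lerD// normc_supnorm.
Qed.

Fact supnormZ_le (a : R[i]) f : supnorm (a *: f) <= normc a * supnorm f.
Proof.
apply: supnorm_le => [|x]; first by rewrite mulr_ge0 ?normc_ge0 ?supnorm_ge0.
by rewrite ComplexField.Normc.normcM ler_wpM2l ?normc_ge0 ?normc_supnorm.
Qed.

Fact supnormZ (a : R[i]) f : (supnorm (a *: f))%:C = `|a| * (supnorm f)%:C.
Proof.
rewrite normrcE -rmorphM; congr (_%:C); apply/eqP; rewrite eq_le supnormZ_le /=.
have [->|a0] := eqVneq a 0.
  by rewrite scale0r ComplexField.Normc.normc0 mul0r supnorm_ge0.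
rewrite -[in X in X <= _](scalerK a0 f).
have na0 : 0 < normc a by rewrite -ltcR -normrcE normr_gt0.
rewrite -ler_pdivlMl// -ComplexField.Normc.normcV; exact: supnormZ_le.
Qed.

Fact supnorm0_eq0 f : (supnorm f)%:C = 0 -> f = 0.
Proof.
move=> [] f0; apply/contFunP => x; apply: ComplexField.Normc.eq0_normc.
by apply/eqP; rewrite eq_le normc_ge0 andbT -f0 normc_supnorm.
Qed.

HB.instance Definition _ :=
  Lmodule_isNormed.Build R[i] contFun supnormD supnormZ supnorm0_eq0.

Lemma contFun_normE f : `|f| = (supnorm f)%:C.
Proof. by []. Qed.

Lemma supnormM f g : supnorm (f * g) <= supnorm f * supnorm g.
Proof.
apply: supnorm_le => [|x]; first by rewrite mulr_ge0 ?supnorm_ge0.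
by rewrite ComplexField.Normc.normcM ler_pM ?normc_ge0 ?normc_supnorm.
Qed.

End continuous_functions.

Section continuous_functions_complete.
Variables (R : realType) (X : compactHausdorffType).
Local Notation normc := (@ComplexField.Normc.normc R).

Lemma normcB_supnorm (f g : contFun R X) x : normc (f x - g x) <= supnorm (f - g).
Proof. exact: (normc_supnorm (f - g)). Qed.

Lemma contFun_complete (F : set_system (contFun R X)) :
  ProperFilter F -> cauchy F -> cvg F.
Proof.
move=> FF /cauchy_ballP F_cauchy.
have F_small (e : R) : 0 < e -> exists A B, [/\ F A, F B &
    forall f g, A f -> B g -> supnorm (f - g) < e].
  move=> e0; have /F_cauchy : 0 < e%:C by rewrite ltcR.
  rewrite !near2E /= => -[[A B] /= [FA FB] AB]; exists A, B; split=> // f g Af Bg.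
  by have := AB (f, g) (conj Af Bg); rewrite -ball_normE /= contFun_normE ltcR.
pose ev x (f : contFun R X) := f x.
have pt_cvg x : cvg (ev x @ F).
  apply: (@cauchy_cvg R[i] (ev x @ F) _); apply/cauchy_ballP => e /complex_pos [r r0 ->].
  have [A [B [FA FB AB]]] := F_small r r0; rewrite !near2E /=.
  exists (ev x @` A, ev x @` B) => /=.
    by split; [apply: (@filterS _ F _ A) FA | apply: (@filterS _ F _ B) FB] => f ?; exists f.
  move=> [z w] [/= [f Af <-] [g Bg <-]]; rewrite -ball_normE /= normrcE ltcR.
  exact: le_lt_trans (normcB_supnorm _ _ _) (AB _ _ Af Bg).
pose l x := lim (ev x @ F).
have l_unif (e : R) : 0 < e -> \forall f \near F, forall x, normc (l x - ev x f) <= e.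
  move=> e0; have [A [B [FA FB AB]]] := F_small e e0.
  apply: filterS FB => g Bg x; apply/ler_addgt0Pr => d d0.
  have /cvgrPdist_lt /(_ d%:C) := pt_cvg x.
  rewrite ltcR => /(_ d0) near_l.
  have [f [/= lf Af]] := filter_ex (filterI near_l FA).
  rewrite -lecR -normrcE -(subrKA (f x)) (le_trans (ler_normD _ _))//.
  rewrite addrC rmorphD lerD//; last exact: ltW.
  rewrite normrcE lecR ltW//; exact: le_lt_trans (normcB_supnorm _ _ _) (AB _ _ Af Bg).
have l_cts : l \in @continuous_pred R X.
  apply/asboolP => x.
  apply/(@cvgrPdist_lt _ _ _ (nbhs x) (nbhs_filter x)) => e /complex_pos[r r0 ->].
  have r30 : 0 < r / 3 by rewrite divr_gt0.
  have [f lf] := filter_ex (l_unif _ r30).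
  have /cvgrPdist_lt /(_ (r / 3)%:C) := @contFun_continuous _ _ f x.
  rewrite ltcR => /(_ r30); apply: filterS => y; rewrite !normrcE !ltcR => fxy.
  have -> : l x - l y = (l x - f x) + (f x - f y) - (l y - f y).
    by ring.
  rewrite -ltcR -normrcE (le_lt_trans (ler_normB _ _))//.
  have -> : r = r / 3 + r / 3 + r / 3 by field.
  rewrite 2!rmorphD/=; apply: ltr_leD; last by rewrite normrcE lecR; exact: lf.
  rewrite (le_lt_trans (ler_normD _ _))//.
  by apply: ler_ltD; rewrite normrcE ?lecR ?ltcR//; exact: lf.
pose L := ContFun l_cts; apply/cvg_ex; exists L.
apply/cvgrPdist_lt => e /complex_pos[r r0 ->].
have r20 : 0 < r / 2 by rewrite divr_gt0.
apply: filterS (l_unif _ r20) => f lf; rewrite contFun_normE ltcR.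
apply: (@le_lt_trans _ _ (r / 2)); last by rewrite ltr_pdivrMr// ltr_pMr// ltr1n.
by apply: supnorm_le; [exact: ltW | exact: lf].
Qed.

HB.instance Definition _ :=
  Uniform_isComplete.Build (contFun R X) contFun_complete.

End continuous_functions_complete.

Section real_esum.
Variables (R : realType) (I : choiceType).
Implicit Types a : I -> R.

Lemma esum_fset_le a (B : {fset I}) : (forall i, 0 <= a i) ->
  ((\sum_(i <- B) a i)%:E <= \esum_(i in setT) (a i)%:E)%E.
Proof.
move=> a0; apply: esum_ge; exists [set` B]; first by split.
by rewrite fsbig_finite//= set_fsetK sumEFin.
Qed.

Lemma esum_le a (M : R) :
  (forall B : {fset I}, \sum_(i <- B) a i <= M) ->
  (\esum_(i in setT) (a i)%:E <= M%:E)%E.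
Proof.
move=> aM; apply: ge_ereal_sup => _ [B [finB _] <-].
by rewrite fsbig_finite//= sumEFin lee_fin.
Qed.

End real_esum.

Section unconditional_sum.
Variables (R : realType) (X : compactHausdorffType) (I : choiceType).
Variable h : I -> contFun R X.

Let S := (\esum_(i in setT) (supnorm (h i))%:E)%E.
Hypothesis S_fin : (S < +oo)%E.

Let h0 i : 0 <= supnorm (h i). Proof. exact: supnorm_ge0. Qed.

Let S_fin_num : S \is a fin_num.
Proof. by rewrite ge0_fin_numE// esum_ge0// => i _; rewrite lee_fin. Qed.

Let partial_sumE B : summability.partial_sum h B = \sum_(i <- B) h i.
Proof. by rewrite big_seq_fsetE. Qed.

Lemma supnorm_sum (B : seq I) :
  supnorm (\sum_(i <- B) h i) <= \sum_(i <- B) supnorm (h i).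
Proof.
rewrite -lecR -contFun_normE (le_trans (ler_norm_sum _ _ _))//.
by rewrite rmorph_sum.
Qed.

Lemma fset_sum_le (B : {fset I}) : \sum_(i <- B) supnorm (h i) <= fine S.
Proof. by rewrite -lee_fin fineK// esum_fset_le. Qed.

Lemma abs_summable_cvg : cvg (summability.partial_sum h @ summability.totally).
Proof.
have FF := @summability.totally_filter I.
apply: cauchy_cvg; apply: cauchy_exP => e /complex_pos[r r0 ->].
have [A SA] : exists A : {fset I}, fine S - r < \sum_(i <- A) supnorm (h i).
  apply/not_existsP => noA.
  suff : (S <= (fine S - r)%:E)%E.
    by rewrite -[in X in (X <= _)%E](fineK S_fin_num) lee_fin; lra.
  by apply: esum_le => B; rewrite leNgt; apply/negP/noA.
exists (summability.partial_sum h A); exists A => //= B AB.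
rewrite -ball_normE /= !partial_sumE distrC contFun_normE ltcR.
have splitB (V : nmodType) (F : I -> V) : \sum_(i <- B) F i =
    \sum_(i <- A) F i + \sum_(i <- [fset x in B | x \notin A]%fset) F i.
  rewrite (big_fsetID _ (mem A)) /=; congr (_ + _); apply: eq_fbigl => i.
  by rewrite !inE andbC; case: (boolP (i \in A)) => //= /(fsubsetP AB).
rewrite splitB addrC addKr (le_lt_trans (supnorm_sum _))//.
have := fset_sum_le B; rewrite splitB; lra.
Qed.

Lemma supnorm_unconditional_sum : supnorm (summability.sum h) <= fine S.
Proof.
have FF := @summability.totally_filter I.
apply/ler_addgt0Pr => e e0.
have /cvgrPdist_lt /(_ e%:C) := abs_summable_cvg.
rewrite ltcR => /(_ e0) /filter_ex [B]; rewrite contFun_normE ltcR => hB.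
rewrite -lecR -contFun_normE -(subrK (summability.partial_sum h B) (summability.sum h)).
rewrite (le_trans (ler_normD _ _))// addrC rmorphD lerD//.
  rewrite contFun_normE lecR partial_sumE.
  exact: le_trans (supnorm_sum _) (fset_sum_le _).
by rewrite contFun_normE lecR ltW.
Qed.

End unconditional_sum.

Section ell1.
Variables (R : realType) (G : groupType) (X : compactHausdorffType).

Definition normsum (h : G -> contFun R X) : \bar R :=
  \esum_(s in setT) (supnorm (h s))%:E.

Definition ell1_pred : {pred G -> contFun R X} := [pred h | (normsum h < +oo)%E].

(* The normed space l^1(G, C(X)); the action enters only in the product ell1_mul
   and the involution ell1_star. *)
Record ell1 := Ell1 {
  ell1_val :> G -> contFun R X ;
  ell1_in : ell1_val \in ell1_pred
}.

HB.instance Definition _ := [isSub for ell1_val].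
HB.instance Definition _ := [Choice of ell1 by <:].

Implicit Types h k : G -> contFun R X.

Lemma normsum_ge0 h : (0 <= normsum h)%E.
Proof. by apply: esum_ge0 => s _; rewrite lee_fin supnorm_ge0. Qed.

Lemma normsumD h k : (normsum (h + k)%R <= normsum h + normsum k)%E.
Proof.
rewrite /normsum -esumD//; try by move=> s _; rewrite lee_fin supnorm_ge0.
by apply: le_esum => s _; rewrite -EFinD lee_fin -lecR rmorphD supnormD.
Qed.

Lemma normsum_ell1 (f : ell1) : normsum f = (fine (normsum f))%:E.
Proof. by rewrite fineK// ge0_fin_numE ?normsum_ge0//; case: f. Qed.

Lemma normsumZ_le (a : R[i]) h : h \in ell1_pred ->
  (normsum (a *: h)%R <= (ComplexField.Normc.normc a * fine (normsum h))%:E)%E.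
Proof.
move=> h1; apply: esum_le => B.
apply: (@le_trans _ _ (ComplexField.Normc.normc a * \sum_(s <- B) supnorm (h s))).
  by rewrite mulr_sumr ler_sum// => s _; exact: supnormZ_le.
by rewrite ler_wpM2l ?normc_ge0// fset_sum_le.
Qed.

Fact ell1_submod : GRing.subsemimod_closed ell1_pred.
Proof.
split; first split.
- rewrite !inE /normsum esum1// => s _.
  by congr (_%:E); have [] : `|0 : contFun R X| = 0 by rewrite normr0.
- move=> h k; rewrite !inE => h1 k1.
  by rewrite (le_lt_trans (normsumD _ _))// lte_add_pinfty.
- by move=> a h /normsumZ_le ha; rewrite inE (le_lt_trans (ha a))// ltry.
Qed.

HB.instance Definition _ :=
  GRing.SubChoice_isSubLmodule.Build R[i] (G -> contFun R X)%type ell1_pred ell1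
    ell1_submod.

Implicit Types f g : ell1.

Definition ell1norm f : R := fine (normsum f).

Fact ell1normD f g : (ell1norm (f + g))%:C <= (ell1norm f)%:C + (ell1norm g)%:C.
Proof.
rewrite -rmorphD lecR -lee_fin EFinD /ell1norm -!normsum_ell1; exact: normsumD.
Qed.

Fact ell1normZ_le (a : R[i]) f :
  ell1norm (a *: f) <= ComplexField.Normc.normc a * ell1norm f.
Proof.
by rewrite -lee_fin {1}/ell1norm -normsum_ell1; apply: normsumZ_le; case: f.
Qed.

Lemma supnorm_ell1norm f s : supnorm (f s) <= ell1norm f.
Proof.
have := @esum_fset_le R G (fun s => supnorm (f s)) [fset s]%fset.
rewrite big_seq_fset1 => /(_ (fun=> supnorm_ge0 _)).
by rewrite -/(normsum f) normsum_ell1 lee_fin.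
Qed.

Lemma ell1norm_ge0 f : 0 <= ell1norm f.
Proof. by rewrite fine_ge0// normsum_ge0. Qed.

Fact ell1normZ (a : R[i]) f : (ell1norm (a *: f))%:C = `|a| * (ell1norm f)%:C.
Proof.
rewrite normrcE -rmorphM; congr (_%:C); apply/eqP; rewrite eq_le ell1normZ_le /=.
have [->|a0] := eqVneq a 0.
  by rewrite scale0r ComplexField.Normc.normc0 mul0r ell1norm_ge0.
rewrite -[in X in X <= _](scalerK a0 f).
have na0 : 0 < ComplexField.Normc.normc a by rewrite -ltcR -normrcE normr_gt0.
rewrite -ler_pdivlMl// -ComplexField.Normc.normcV; exact: ell1normZ_le.
Qed.

Fact ell1norm0_eq0 f : (ell1norm f)%:C = 0 -> f = 0.
Proof.
move=> [] f0; apply/val_inj/funext => s; apply: supnorm0_eq0; congr (_%:C).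
by apply/eqP; rewrite eq_le supnorm_ge0 andbT -f0 supnorm_ell1norm.
Qed.

HB.instance Definition _ :=
  Lmodule_isNormed.Build R[i] ell1 ell1normD ell1normZ ell1norm0_eq0.

Lemma ell1_normE f : `|f| = (ell1norm f)%:C.
Proof. by []. Qed.

End ell1.

(* Each tact s is a homeomorphism, with inverse tact s^-1 (see tactK and tactVK).
   G carries no topology: it is a discrete group. *)
Record topAction (G : groupType) (X : topologicalType) := TopAction {
  tact :> G -> X -> X ;
  tact_continuous : forall s, continuous (tact s) ;
  tact1 : forall x, tact 1%g x = x ;
  tactM : forall s t x, tact (s * t)%g x = tact s (tact t x)
}.

Section topAction_theory.
Variables (G : groupType) (X : topologicalType) (sigma : topAction G X).

Lemma tactK s : cancel (sigma s) (sigma s^-1%g).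
Proof. by move=> x; rewrite -tactM mulVg tact1. Qed.

Lemma tactVK s : cancel (sigma s^-1%g) (sigma s).
Proof. by move=> x; rewrite -tactM mulgV tact1. Qed.

Definition topologically_free :=
  dense [set x | forall s, s <> 1%g -> sigma s x <> x].

Definition invariant_set (Y : set X) := forall s x, Y x -> Y (sigma s x).

Definition minimal_action :=
  forall Y : set X, closed Y -> invariant_set Y -> Y = set0 \/ Y = setT.

End topAction_theory.

Section crossed_product.
Variables (R : realType) (G : groupType) (X : compactHausdorffType).
Variable sigma : topAction G X.
Implicit Types (s t : G) (f g : ell1 R G X) (u v : contFun R X).

Local Notation normc := (@ComplexField.Normc.normc R).

Fact alpha_continuous s u : (u \o sigma s^-1%g) \in @continuous_pred R X.
Proof.
apply/asboolP => x; apply: continuous_comp; first exact: tact_continuous.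
exact: contFun_continuous.
Qed.

Definition alpha s u : contFun R X := ContFun (alpha_continuous s u).

Lemma supnorm_alpha s u : supnorm (alpha s u) = supnorm u.
Proof.
apply/eqP; rewrite eq_le; apply/andP; split; apply: supnorm_le => [|x];
  rewrite ?supnorm_ge0//; first exact: (normc_supnorm u).
by have := normc_supnorm (alpha s u) (sigma s x); rewrite /= tactK.
Qed.

Lemma normc_conj (z : R[i]) : normc z^* = normc z.
Proof. by case: z => a b /=; rewrite sqrrN. Qed.

Fact conj_continuous u : (fun x => (u x)^*) \in @continuous_pred R X.
Proof.
apply/asboolP => x.
apply/(@cvgrPdist_lt _ _ _ (nbhs x) (nbhs_filter x)) => e e0.
have /cvgrPdist_lt /(_ e e0) := @contFun_continuous _ _ u x.
by apply: filterS => y; rewrite -rmorphB !normrcE normc_conj.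
Qed.

Definition conjFun u : contFun R X := ContFun (conj_continuous u).

Lemma supnorm_conj u : supnorm (conjFun u) = supnorm u.
Proof.
rewrite /supnorm (_ : normc \o conjFun u = normc \o u)//; apply/funext => x; exact: normc_conj.
Qed.

Definition conv_term f g s t : contFun R X := f t * alpha t (g (t^-1 * s)%g).

Lemma normsum_translate f t :
  (\esum_(s in setT) (supnorm (f (t^-1 * s)%g))%:E = normsum f)%E.
Proof.
rewrite -(reindex_esum [set: G] [set: G] (fun s => t^-1 * s)%g
  (fun s => (supnorm (f s))%:E))//.
split=> // [s s' _ _ /mulgI//|s _]; by exists (t * s)%g; rewrite // mulKg.
Qed.

Lemma supnorm_conv_term f g s t :
  supnorm (conv_term f g s t) <= supnorm (f t) * supnorm (g (t^-1 * s)%g).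
Proof. by rewrite (le_trans (supnormM _ _))// supnorm_alpha. Qed.

Lemma conv_term_summable f g s :
  (\esum_(t in setT) (supnorm (conv_term f g s t))%:E < +oo)%E.
Proof.
apply: le_lt_trans (ltry (ell1norm f * ell1norm g)); apply: esum_le => B.
apply: (@le_trans _ _ (\sum_(t <- B) supnorm (f t) * ell1norm g)).
  apply: ler_sum => t _; rewrite (le_trans (supnorm_conv_term _ _ _ _))//.
  by rewrite ler_wpM2l ?supnorm_ge0// supnorm_ell1norm.
rewrite -mulr_suml ler_wpM2r ?ell1norm_ge0// -lee_fin -normsum_ell1.
by apply: esum_fset_le => t; exact: supnorm_ge0.
Qed.

(* summability.sum is the limit, for the norm of C(X), of the net of the finite
   partial sums; it exists by conv_term_summable and abs_summable_cvg. *)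
Definition ell1_conv f g s : contFun R X := summability.sum (conv_term f g s).

Lemma normsum_conv f g : (normsum (ell1_conv f g) <= (ell1norm f * ell1norm g)%:E)%E.
Proof.
apply: esum_le => B; rewrite -lee_fin -sumEFin.
apply: (@le_trans _ _ (\sum_(s <- B) \esum_(t in setT)
    (supnorm (f t) * supnorm (g (t^-1 * s)%g))%:E)%E).
  apply: lee_sum => s _.
  apply: (@le_trans _ _ (\esum_(t in setT) (supnorm (conv_term f g s t))%:E)%E).
    have cvg_s := conv_term_summable f g s.
    rewrite -[leRHS]fineK; last first.
      rewrite ge0_fin_numE// esum_ge0// => t _; by rewrite lee_fin supnorm_ge0.
    by rewrite lee_fin; exact: supnorm_unconditional_sum.
  by apply: le_esum => t _; rewrite lee_fin supnorm_conv_term.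
rewrite -esum_sum; last first.
  by move=> t s _ _; rewrite lee_fin mulr_ge0 ?supnorm_ge0.
under eq_esum do rewrite sumEFin.
apply: esum_le => A.
apply: (@le_trans _ _ (\sum_(t <- A) supnorm (f t) * ell1norm g)).
  apply: ler_sum => t _; rewrite -mulr_sumr ler_wpM2l ?supnorm_ge0//.
  rewrite -lee_fin -normsum_ell1 -(normsum_translate g t).
  by apply: esum_fset_le => s; exact: supnorm_ge0.
rewrite -mulr_suml ler_wpM2r ?ell1norm_ge0// -lee_fin -normsum_ell1.
by apply: esum_fset_le => t; exact: supnorm_ge0.
Qed.

Fact conv_ell1 f g : ell1_conv f g \in @ell1_pred R G X.
Proof. by rewrite inE (le_lt_trans (normsum_conv f g))// ltry. Qed.

Definition ell1_mul f g : ell1 R G X := Ell1 (conv_ell1 f g).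

Fact star_ell1 f : (fun s => alpha s (conjFun (f s^-1%g))) \in @ell1_pred R G X.
Proof.
rewrite inE /normsum; under eq_esum do rewrite supnorm_alpha supnorm_conj.
rewrite -(reindex_esum [set: G] [set: G] (fun s => s^-1)%g (fun s => (supnorm (f s))%:E)).
  by case: f.
by split=> // [s s' _ _ /invg_inj//|s _]; exists s^-1%g; rewrite // invgK.
Qed.

Definition ell1_star f : ell1 R G X := Ell1 (star_ell1 f).

Definition two_sided_ideal (I : set (ell1 R G X)) :=
  [/\ I 0,
      forall f g, I f -> I g -> I (f + g),
      forall (a : R[i]) f, I f -> I (a *: f)
    & forall f g, I f -> I (ell1_mul f g) /\ I (ell1_mul g f)].

Definition self_adjoint (I : set (ell1 R G X)) := forall f, I f -> I (ell1_star f).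

Definition proper_two_sided_ideal (I : set (ell1 R G X)) :=
  [/\ two_sided_ideal I, I <> [set 0] & I <> setT].

End crossed_product.

(* Main.v *)
(* (2) => (3): if Y is a proper nonempty closed invariant set, the functions
   vanishing on Y at every group element form a proper closed self-adjoint ideal.

   (3) => (1): a nonzero closed ideal I contains some f with f(e)(x0) = 1 at a
   free point x0.  Outside a finite A in G the norm of f is small, and a bump h
   supported in a small neighbourhood of x0 kills the terms of h f h indexed by
   A \ {e}; hence r := h^2 - h f h has norm at most 1/2.  If w is a bump with
   w h = w, then w - w r = w (h f h) lies in I, hence so does w - w r^n for all n,
   and w lies in I since I is closed.  By minimality and compactness a finite sum
   of translates of w >= 0 is positive, hence an invertible element of C(X) in I. *)

Require Import Defs.
From mathcomp Require Import all_boot all_order all_algebra finmap.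
From mathcomp Require Import all_classical all_reals all_analysis.
From mathcomp Require Import complex ring lra.
From mathcomp.analysis.showcase Require summability.
Set Implicit Arguments.
Unset Strict Implicit.
Unset Printing Implicit Defensive.
Import Order.TTheory GRing.Theory Num.Theory.
Import numFieldNormedType.Exports.
Local Open Scope classical_set_scope.
Local Open Scope ring_scope.
Local Open Scope complex_scope.

Lemma normcN (R : realType) (z : R[i]) :
  ComplexField.Normc.normc (- z) = ComplexField.Normc.normc z.
Proof. by case: z => a b /=; rewrite !sqrrN. Qed.

Lemma normc_real (R : realType) (a : R) : 0 <= a -> ComplexField.Normc.normc a%:C = a.
Proof. by move=> a0; rewrite /= expr0n /= addr0 sqrtr_sqr ger0_norm. Qed.

(** * Unconditional sums in C(X) *)

Section unconditional_sums.
Variables (R : realType) (X : compactHausdorffType) (I : choiceType).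
Implicit Types h k : I -> contFun R X.

(** The net of partial sums is constant as soon as the finite index set contains [i0]. *)
Lemma sum_single h i0 : (forall i, i != i0 -> h i = 0) -> summability.sum h = h i0.
Proof.
move=> h0; have FF := @summability.totally_filter I.
apply: (@cvg_lim (contFun R X)); first exact: norm_hausdorff.
apply: cvg_near_cst; exists [fset i0]%fset => //= B /=; rewrite fsub1set => i0B.
rewrite -[LHS](big_seq_fsetE _ _ predT) (big_fsetD1 i0) //=.
by rewrite big1_fset ?addr0 // => i; rewrite !inE => /andP[/h0 -> _].
Qed.

Lemma sumD h k :
  (\esum_(i in setT) (supnorm (h i))%:E < +oo)%E ->
  (\esum_(i in setT) (supnorm (k i))%:E < +oo)%E ->
  summability.sum (h + k) = summability.sum h + summability.sum k.
Proof.
move=> /abs_summable_cvg hcvg /abs_summable_cvg kcvg.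
have FF := @summability.totally_filter I.
apply: (@cvg_lim (contFun R X)); first exact: norm_hausdorff.
rewrite (_ : summability.partial_sum (h + k) =
  summability.partial_sum h + summability.partial_sum k).
  exact: (@cvgD R[i] (contFun R X) _ (@summability.totally I) FF _ _ _ _ hcvg kcvg).
by apply/funext => B; rewrite /summability.partial_sum [RHS]/GRing.add /= big_split.
Qed.

(** Evaluation at [y] is contractive for the supremum norm and kills every finite partial sum, hence
    also their limit. *)
Lemma sum_vanish h y :
  (\esum_(i in setT) (supnorm (h i))%:E < +oo)%E ->
  (forall i, h i y = 0) -> summability.sum h y = 0.
Proof.
move=> /abs_summable_cvg hcvg h0; have FF := @summability.totally_filter I.
apply: ComplexField.Normc.eq0_normc; apply/eqP; rewrite eq_le normc_ge0 andbT.
apply/ler_addgt0Pr => e e0; rewrite add0r.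
have /cvgrPdist_lt /(_ e%:C) := hcvg.
rewrite ltcR => /(_ e0) /filter_ex [B]; rewrite contFun_normE ltcR => /ltW.
apply: le_trans; apply: le_trans (normc_supnorm _ y).
suff pB : summability.partial_sum h B y = 0.
  rewrite (_ : (_ - _ : contFun R X) y =
    summability.sum h y - summability.partial_sum h B y) // pB subr0.
  exact: lexx.
rewrite /summability.partial_sum.
apply: (big_ind (fun u : contFun R X => u y = 0)) => // u v u0 v0.
by rewrite [LHS](_ : _ = u y + v y) // u0 v0 addr0.
Qed.

End unconditional_sums.

Lemma sum_fset_pred1_le (R : realDomainType) (I : choiceType) (B : {fset I}) i0 (c : R) :
  0 <= c -> \sum_(i <- B | i == i0) c <= c.
Proof.
move=> c0; have [iB|iB] := boolP (i0 \in B).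
  by rewrite -big_filter filter_pred1_uniq ?big_seq1 // fset_uniq.
by rewrite big1_seq // => i /andP[/eqP ->]; rewrite (negPf iB).
Qed.

(** * Convolution and elements supported at one group element *)

Section convolution.
Variables (R : realType) (G : groupType) (X : compactHausdorffType).
Variable sigma : topAction G X.
Implicit Types (s t : G) (f g k : ell1 R G X) (u : contFun R X).

Lemma ell1P f g : f =1 g -> f = g.
Proof. by move=> fg; apply/val_inj/funext. Qed.

Lemma ell1_mulDl f g k :
  ell1_mul sigma (f + g) k = ell1_mul sigma f k + ell1_mul sigma g k.
Proof.
apply: ell1P => s.
rewrite [RHS](_ : _ = ell1_conv sigma f k s + ell1_conv sigma g k s) //.
rewrite -sumD; [|exact: conv_term_summable..].
congr summability.sum; apply/funext => t.
transitivity ((f t + g t) * alpha sigma t (k (t^-1 * s)%g)) => //.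
by rewrite mulrDl.
Qed.

Lemma ell1norm_mul f g :
  ell1norm (ell1_mul sigma f g) <= ell1norm f * ell1norm g.
Proof. by rewrite -lee_fin {1}/ell1norm -normsum_ell1; exact: normsum_conv. Qed.

Fact single_ell1 t u : (fun s => if s == t then u else 0) \in @ell1_pred R G X.
Proof.
rewrite inE (le_lt_trans _ (ltry (supnorm u))) //; apply: esum_le => B.
rewrite (eq_bigr (fun s => if s == t then supnorm u else 0)); last first.
  by move=> s _; case: eqP => // _; have [] : `|0 : contFun R X| = 0 by rewrite normr0.
by rewrite -big_mkcond sum_fset_pred1_le ?supnorm_ge0.
Qed.

(** This is $u\delta_t$. The map $u \mapsto u\delta_e$ embeds C(X) in the algebra, and the
    $\delta_t$ implement the action by conjugation. *)
Definition single t u : ell1 R G X := Ell1 (single_ell1 t u).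

Lemma alpha1 u : alpha sigma 1%g u = u.
Proof. by apply: contFunP => x; rewrite /= invg1 tact1. Qed.

Lemma alpha0 s : alpha sigma s (0 : contFun R X) = 0.
Proof. exact: contFunP. Qed.

Lemma single_mulE t u f s :
  ell1_mul sigma (single t u) f s = u * alpha sigma t (f (t^-1 * s)%g).
Proof.
rewrite [LHS](@sum_single _ _ _ _ t) => [|i /negPf it].
  by rewrite /conv_term /= eqxx.
by rewrite /conv_term /= it mul0r.
Qed.

Lemma mul_singleE t u f s :
  ell1_mul sigma f (single t u) s = f (s * t^-1)%g * alpha sigma (s * t^-1)%g u.
Proof.
rewrite [LHS](@sum_single _ _ _ _ (s * t^-1)%g) => [|i it].
  by rewrite /conv_term /= invgM invgK mulgVK eqxx.
rewrite /conv_term /= ifN ?alpha0 ?mulr0 //.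
apply: contraNneq it => <-; by rewrite invgM invgK mulVKg.
Qed.

End convolution.

(** * Bump functions and neighbourhoods of free points *)

Section bumps.
Variables (R : realType) (X : compactHausdorffType).

Lemma real_continuous_pred (p : X -> R) : continuous p ->
  (fun x => (p x)%:C) \in @continuous_pred R X.
Proof.
move=> pc; apply/asboolP => x.
apply/(@cvgrPdist_lt _ _ _ (nbhs x) (nbhs_filter x)) => e /complex_pos[r r0 ->].
have /cvgrPdist_lt /(_ r r0) := pc x.
apply: filterS => y; rewrite -rmorphB normrcE ltcR /= expr0n /= addr0.
by rewrite sqrtr_sqr.
Qed.

Definition realFun (p : X -> R) (pc : continuous p) : contFun R X :=
  ContFun (real_continuous_pred pc).

Lemma urysohn_bump (V : set X) x0 : nbhs x0 V -> exists p : X -> R,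
  [/\ continuous p, forall x, 0 <= p x <= 1, p x0 = 1 & forall x, ~ V x -> p x = 0].
Proof.
move=> x0V.
have normX := compact_normal (@compactHausdorff_hausdorff X) (@compactHausdorff_compact X).
have cl1 : closed [set x0].
  exact: accessible_closed_set1 (hausdorff_accessible (@compactHausdorff_hausdorff X)) _.
(* Urysohn's lemma is applied to [x0] and the complement of the interior of [V], since [V] itself
   need not be open. *)
have clV : closed (~` V°) by exact/open_closedC/open_interior.
have /(@normal_separatorP R) /(_ _ _ clV cl1) := normX.
have disj : ~` V° `&` [set x0] = set0.
  by rewrite -subset0 => x [/= nV xx0]; apply: nV; rewrite xx0.
move=> /(_ disj) /(@uniform_separatorP _ R) [p [pc p01 p0 p1]].
exists p; split=> // [x||x nV].
- by have := p01 (p x) (imageT p x); rewrite /= in_itv.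
- by apply: (p1 (p x0)); exists x0.
- by apply: (p0 (p x)); exists x => // /interior_subset.
Qed.

Lemma bump_pair (V : set X) x0 : nbhs x0 V -> exists h w : X -> R,
  [/\ continuous h, continuous w, forall x, 0 <= h x <= 1 & forall x, 0 <= w x <= 1] /\
  [/\ w x0 = 1, forall x, ~ V x -> h x = 0 & forall x, w x * h x = w x].
Proof.
move=> /urysohn_bump[p [pc p01 p1 p0]].
have cst (c : R) : continuous (fun _ : X => c) by move=> x; exact: cvg_cst.
have p2c : continuous (fun x => 2 * p x) by move=> x; apply: cvgMr; exact: pc.
(* Both functions are truncations of one Urysohn function [p]: the second is nonzero only where
   [p x > 1/2], and there the first equals 1. *)
exists (fun x => Num.min 1 (2 * p x)), (fun x => Num.max 0 (2 * p x - 1)).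
split; split.
- by apply: min_fun_continuous; [exact: cst|exact: p2c].
- apply: max_fun_continuous; first exact: cst.
  by move=> x; apply: cvgB; [exact: p2c|exact: cst].
- by move=> x; have := p01 x; case: (leP 1 (2 * p x)); lra.
- by move=> x; have := p01 x; case: (leP 0 (2 * p x - 1)); lra.
- by rewrite p1; case: leP; lra.
- by move=> x /p0 ->; rewrite mulr0; case: leP => //; lra.
- move=> x; case: (leP 0 (2 * p x - 1)); last by rewrite mul0r.
  by case: (leP 1 (2 * p x)); rewrite ?mulr1 //; lra.
Qed.

(** For each [s] other than the identity, separate [sigma s^-1 x0] from [x0] by disjoint open sets
    [A] and [C]; the points of [C] that [sigma s^-1] sends into [A] form a neighbourhood that works
    for [s]. Finitely many of these are intersected. For [h] supported in [V], the product of [h x]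
    and [h (sigma s^-1 x)] is then zero. *)
Lemma free_nbhs (G : groupType) (sigma : topAction G X) (B : {fset G}) x0 :
  (forall s, s <> 1%g -> sigma s x0 <> x0) ->
  exists2 V, nbhs x0 V &
    forall s, s \in B -> s <> 1%g -> forall x, V x -> ~ V (sigma s^-1%g x).
Proof.
move=> free.
have near1 s : exists2 V, nbhs x0 V &
    s <> 1%g -> forall x, V x -> ~ V (sigma s^-1%g x).
  have [->|s1] := eqVneq s 1%g; first by exists setT => //; exact: filterT.
  have /eqP ne : sigma s^-1%g x0 <> x0.
    by apply: free => /eqP; rewrite invg_eq1; exact/negP.
  have := @compactHausdorff_hausdorff X; rewrite open_hausdorff.
  move=> /(_ _ _ ne) [[A C] /= [Ax Cx] [oA oC /eqP AC]].
  rewrite !inE in Ax Cx.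
  exists (C `&` sigma s^-1%g @^-1` A).
    apply: filterI; first exact: open_nbhs_nbhs.
    apply: (@tact_continuous _ _ sigma s^-1%g x0).
    exact: open_nbhs_nbhs.
  move=> _ x [_ Ax'] [Cx' _].
  by have : (A `&` C) (sigma s^-1%g x) by []; rewrite AC.
exists (\bigcap_(s in [set` B]) projT1 (cid2 (near1 s))).
  apply: filter_bigI => s _; by case: (cid2 (near1 s)).
move=> s sB s1 x Vx Vsx; case: (cid2 (near1 s)) (Vx s sB) (Vsx s sB) => /= V _.
by move=> /(_ s1 x).
Qed.

End bumps.

Lemma half_pow_small (R : realType) (M e : R) : 0 < e -> exists n, M / 2 ^+ n < e.
Proof.
move=> e0; exists (Num.bound (M / e)).
rewrite ltr_pdivrMr ?exprn_gt0 // mulrC -ltr_pdivrMr //; exact: upper_nthrootP.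
Qed.

(** * Approximation in closed ideals and products of single elements *)

Section ideals.
Variables (R : realType) (G : groupType) (X : compactHausdorffType).
Variable sigma : topAction G X.
Implicit Types (s t : G) (f g k : ell1 R G X) (u v : contFun R X).
Implicit Types I : set (ell1 R G X).
Local Notation "f ** g" := (ell1_mul sigma f g) (at level 40).
Local Notation normc := (@ComplexField.Normc.normc R).
Local Notation single := (@single R G X).

Lemma ell1_mulBl f g k : (f - g) ** k = f ** k - g ** k.
Proof. by apply/eqP; rewrite eq_sym subr_eq -ell1_mulDl subrK. Qed.

Lemma closed_approx I f : closed I ->
  (forall e : R, 0 < e -> exists2 g, I g & ell1norm (f - g) < e) -> I f.
Proof.
move=> clI fI; apply: clI => B /nbhs_ballP[_ /complex_pos[e e0 ->] eB].
have [g Ig fg] := fI e e0; exists g; split=> //; apply: eB.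
by rewrite -ball_normE /= ell1_normE ltcR.
Qed.

(** Modulo [I], [f] is unchanged by right multiplication by [r]. The iterates [y n], that is $f
    r^n$, thus satisfy [f - y n] in [I] by telescoping, while their norms decay like $2^{-n}$; so
    [f] is a limit of elements of [I]. *)
Lemma ideal_contraction I f r : two_sided_ideal sigma I -> closed I ->
  ell1norm r <= 1 / 2 -> I (f - f ** r) -> I f.
Proof.
move=> [I0 ID IZ IM] clI r2 Ifr.
pose y n := iter n (fun k => k ** r) f.
have Iy n : I (y n - y n.+1).
  elim: n => [//|n IHn].
  by rewrite [y n.+2]iterS [y n.+1]iterS -/(y n) -ell1_mulBl; have [] := IM _ r IHn.
have Ify n : I (f - y n).
  elim: n => [|n IHn]; first by rewrite subrr.
  by rewrite -(subrKA (y n)); exact: ID.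
have y_le n : ell1norm (y n) <= ell1norm f / 2 ^+ n.
  elim: n => [|n IHn]; first by rewrite expr0 divr1.
  rewrite [y _]iterS (le_trans (ell1norm_mul _ _ _)) //.
  rewrite exprSr invfM mulrA ler_pM ?ell1norm_ge0 //; lra.
apply: closed_approx => // e /(half_pow_small (ell1norm f)) [n small].
exists (f - y n) => //; rewrite opprB addrC subrK.
exact: le_lt_trans (y_le n) small.
Qed.

Lemma single1_mulE u f s : (single 1%g u ** f) s = u * f s.
Proof. by rewrite single_mulE alpha1 invg1 mul1g. Qed.

Lemma mul_single1E u f s : (f ** single 1%g u) s = f s * alpha sigma s u.
Proof. by rewrite mul_singleE invg1 mulg1. Qed.

Lemma single_mul_single s t u v :
  single s u ** single t v = single (s * t)%g (u * alpha sigma s v).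
Proof.
apply: ell1P => q; rewrite single_mulE /=.
rewrite -[q == _](can_eq (mulKg s^-1%g)) mulKg.
by case: eqP; rewrite ?alpha0 ?mulr0.
Qed.

Lemma ell1_mul1f f : single 1%g 1 ** f = f.
Proof. by apply: ell1P => s; rewrite single1_mulE mul1r. Qed.

(** * From a nonzero closed ideal to a bump function in it *)

Lemma ell1_tail f (e : R) : 0 < e -> exists A : {fset G}, forall B : {fset G},
  \sum_(s <- B | s \notin A) supnorm (f s) <= e.
Proof.
move=> e0.
(* The norm is the supremum of the finite sums, so some [A] comes within [e] of it; what [B] adds
   outside [A] must fit in that gap. *)
have [A SA] : exists A : {fset G}, ell1norm f - e < \sum_(s <- A) supnorm (f s).
  apply/not_existsP => noA.
  suff : (normsum f <= (ell1norm f - e)%:E)%E.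
    by rewrite normsum_ell1 lee_fin -/(ell1norm f); lra.
  by apply: esum_le => B; rewrite leNgt; apply/negP/noA.
exists A => B.
have := @esum_fset_le R G (fun s => supnorm (f s)) (A `|` B)%fset
  (fun=> supnorm_ge0 _).
rewrite -/(normsum f) normsum_ell1 lee_fin -/(ell1norm f).
rewrite (big_fsetID _ (mem A)) /=.
have -> : \sum_(s <- [fset x in (A `|` B)%fset | x \in A]%fset) supnorm (f s) =
    \sum_(s <- A) supnorm (f s).
  by apply: eq_fbigl => s; rewrite !inE; case: (s \in A); rewrite ?andbF ?andbT.
have -> : \sum_(s <- [fset x in (A `|` B)%fset | x \notin A]%fset) supnorm (f s) =
    \sum_(s <- B | s \notin A) supnorm (f s).
  rewrite [RHS]big_fset_condE; apply: eq_fbigl => s; rewrite !inE.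
  by case: (s \in A); rewrite ?andbF ?andbT.
lra.
Qed.

(** Right multiplication by $\delta_{s^{-1}}$ moves a nonzero coefficient from [s] to the identity.
    The set where that coefficient is nonzero is open and nonempty, so it contains a free point by
    density; scaling makes the value there 1. *)
Lemma ideal_free_normalized I f : topologically_free sigma ->
  two_sided_ideal sigma I -> I f -> f <> 0 ->
  exists2 g, I g & exists2 x, forall s, s <> 1%g -> sigma s x <> x & g 1%g x = 1.
Proof.
move=> free [I0 ID IZ IM] If f0.
have [s [x fsx]] : exists s x, f s x <> 0.
  apply: contra_notP f0 => /forallNP f0; apply: ell1P => s; apply: contFunP => x.
  by have /forallNP /(_ x) /contrapT := f0 s.
pose f1 := f ** single s^-1%g 1.
have f1E : f1 1%g = f s.
  rewrite /f1 mul_singleE invgK mul1g.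
  by rewrite (_ : alpha sigma s 1 = 1) ?mulr1 //; exact: contFunP.
case: (free (f1 1%g @^-1` [set~ 0])).
- by exists x => /= f10; apply: fsx; rewrite -f1E.
- apply: open_comp; first by move=> y _; exact: contFun_continuous.
  apply/closed_openC; apply: accessible_closed_set1.
  exact/hausdorff_accessible/norm_hausdorff.
- move=> x0 [/= f1x0 x0free].
  exists ((f1 1%g x0)^-1 *: f1); first by apply: IZ; have [] := IM _ (single s^-1%g 1) If.
  by exists x0 => //; apply: mulVf; exact/eqP.
Qed.

Lemma ideal_bump I f : topologically_free sigma ->
  two_sided_ideal sigma I -> closed I -> I f -> f <> 0 ->
  exists (p : X -> R) (pc : continuous p),
    [/\ forall x, 0 <= p x, exists x, p x <> 0 & I (single 1%g (realFun pc))].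
Proof.
move=> free Iid clI If0 f00.
have {f f00 If0} [f If [x0 x0free fx0]] := ideal_free_normalized free Iid If0 f00.
(* The bound 1/2 on the norm of [r] is split evenly: 1/4 for the coefficient at the identity and 1/4
   for the tail outside [A]. *)
have q0 : 0 < 1 / 4 :> R by lra.
have [A fA] := ell1_tail f q0.
have [V1 x0V1 VA] := free_nbhs A x0free.
have x0V2 : nbhs x0 [set x | normc (1 - f 1%g x) < 1 / 4].
  have /cvgrPdist_lt /(_ (1 / 4)%:C) := @contFun_continuous _ _ (f 1%g) x0.
  by rewrite ltcR fx0 => /(_ q0); apply: filterS => x; rewrite normrcE ltcR.
have [h [w [[hc wc h01 w01] [wx0 h0 wh]]]] := @bump_pair R X _ _ (filterI x0V1 x0V2).
exists w, wc; split; first by move=> x; case/andP: (w01 x).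
  by exists x0; rewrite wx0; apply/eqP; rewrite oner_eq0.
pose H := realFun hc; pose W := realFun wc.
have WH : W * H = W.
  by apply: contFunP => x; rewrite [LHS](_ : _ = (w x)%:C * (h x)%:C) // -rmorphM wh.
pose a := single 1%g H ** (f ** single 1%g H).
have aE s : a s = H * (f s * alpha sigma s H).
  by rewrite single1_mulE mul_single1E.
have Ia : I a.
  have [_ _ _ IM] := Iid.
  by have [_] := IM _ (single 1%g H) (IM _ (single 1%g H) If).1.
pose r := single 1%g (H * H) - a.
have rE s : r s = (if s == 1%g then H * H else 0) - a s by [].
apply: (@ideal_contraction _ _ r) => //; last first.
  (* Since [W * H = W], multiplying by [W] absorbs $H^2$, so only the term with [a], which lies in
     [I], remains. *)
  suff -> : single 1%g W - single 1%g W ** r = single 1%g W ** a.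
    by have [_ _ _ IM] := Iid; have [_] := IM _ (single 1%g W) Ia.
  apply: ell1P => s.
  transitivity ((if s == 1%g then W else 0) - (single 1%g W ** r) s) => //.
  rewrite (single1_mulE W r) (single1_mulE W a) rE mulrBr.
  move: (a s) => b; case: eqP => _; first by rewrite mulrA !WH subKr.
  by rewrite mulr0 !sub0r opprK.
(* This coefficient is $h^2(1 - f(e))$: it vanishes where [h] does, and [f 1] is within 1/4 of 1
   elsewhere. *)
have r1 : supnorm (r 1%g) <= 1 / 4.
  apply: supnorm_le => [|x]; first lra.
  rewrite rE eqxx aE alpha1.
  rewrite [X in normc X](_ : _ = (h x)%:C * (h x)%:C - (h x)%:C * (f 1%g x * (h x)%:C)) //.
  have [|/h0 ->] := pselect ((V1 `&` [set x | normc (1 - f 1%g x) < 1 / 4]) x); last first.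
    by rewrite !mul0r subrr ComplexField.Normc.normc0; lra.
  move=> [_ /= fx].
  rewrite (_ : _ - _ = (h x)%:C * (h x)%:C * (1 - f 1%g x)); last by ring.
  have /andP[hx0 hx1] := h01 x.
  rewrite !ComplexField.Normc.normcM normc_real //.
  by have := normc_ge0 (1 - f 1%g x); nra.
(* Here [r s x] is $-h(x) f(s)(x) h(\sigma_s^{-1}x)$. For [s] in [A] the two values of [h] are never
   both nonzero, by the choice of [V1]; for other [s] they are at most 1. *)
have rs s : s != 1%g -> supnorm (r s) <= if s \notin A then supnorm (f s) else 0.
  move=> s1; apply: supnorm_le => [|x]; first by case: ifP; rewrite ?supnorm_ge0.
  rewrite rE (negPf s1) aE.
  rewrite [X in normc X](_ : _ = 0 - (h x)%:C * (f s x * (h (sigma s^-1%g x))%:C)) //.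
  rewrite sub0r normcN !ComplexField.Normc.normcM.
  have /andP[hx0 hx1] := h01 x.
  have /andP[hy0 hy1] := h01 (sigma s^-1%g x).
  rewrite !normc_real //.
  case: ifPn => [_|/negPn sA].
    apply: le_trans (normc_supnorm _ x).
    by rewrite mulrCA ler_piMr ?normc_ge0 // mulr_ile1.
  have [[Vx _]|/h0 ->] := pselect ((V1 `&` [set x | normc (1 - f 1%g x) < 1 / 4]) x);
    last by rewrite mul0r.
  rewrite (h0 (sigma s^-1%g x)) ?mulr0 // => -[+ _].
  by apply: VA Vx => //; exact/eqP.
rewrite -lee_fin {1}/ell1norm -normsum_ell1; apply: esum_le => B.
apply: (@le_trans _ _ (\sum_(s <- B) ((if s == 1%g then 1 / 4 else 0) +
    (if s \notin A then supnorm (f s) else 0)))).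
  apply: ler_sum => s _; have [->|s1] := eqVneq s 1%g; last by rewrite add0r rs.
  by rewrite (le_trans r1) // lerDl; case: ifP; rewrite ?supnorm_ge0.
rewrite big_split /= -!big_mkcond /= (_ : 1 / 2 = 1 / 4 + 1 / 4); last by field.
by apply: lerD; [exact/sum_fset_pred1_le/ltW|exact: fA].
Qed.

(** * From a bump function in the ideal to the whole algebra *)

Lemma ideal_full I : two_sided_ideal sigma I -> I (single 1%g 1) -> I = setT.
Proof.
move=> [_ _ _ IM] I1; apply/seteqP; split=> // f _.
by rewrite -(ell1_mul1f f); have [] := IM _ f I1.
Qed.

Lemma inv_continuous u : (forall x, u x != 0) ->
  (fun x => (u x)^-1) \in @continuous_pred R X.
Proof.
move=> u0; apply/asboolP => x; apply: cvgV => //; exact: contFun_continuous.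
Qed.

Lemma ideal_unit I u : two_sided_ideal sigma I -> I (single 1%g u) ->
  (forall x, u x != 0) -> I = setT.
Proof.
move=> Iid Iu u0; apply: ideal_full => //; have [_ _ _ IM] := Iid.
have [+ _] := IM _ (single 1%g (ContFun (inv_continuous u0))) Iu.
rewrite single_mul_single mulg1 alpha1 (_ : u * _ = 1) //.
by apply: contFunP => x; exact: (mulfV (u0 x)).
Qed.

Lemma contFun_sumE (J : Type) (l : seq J) (F : J -> contFun R X) x :
  (\sum_(i <- l) F i) x = \sum_(i <- l) F i x.
Proof. exact: (big_morph (fun u : contFun R X => u x)). Qed.

Lemma ideal_positive_full I (p : X -> R) (pc : continuous p) :
  minimal_action sigma -> two_sided_ideal sigma I -> (forall x, 0 <= p x) ->
  (exists x, p x <> 0) -> I (single 1%g (realFun pc)) -> I = setT.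
Proof.
move=> mini Iid p0 [x0 px0] Ip.
(* The points whose orbit misses the support of [p] form a closed invariant set that omits [x0];
   minimality makes it empty. *)
pose Y := [set x | forall s, p (sigma s x) = 0].
have openp s : open [set x | p (sigma s x) != 0].
  apply: (@open_comp _ _ (p \o sigma s) [set y | y != 0]) => [x _|].
    by apply: continuous_comp; [exact: tact_continuous|exact: pc].
  exact: open_neq.
have clY : closed Y.
  rewrite (_ : Y = ~` \bigcup_s [set x | p (sigma s x) != 0]).
    by apply/open_closedC/bigcup_open => s _.
  apply/seteqP; split => x /= Yx; first by move=> [s _ /=]; rewrite Yx eqxx.
  by move=> s; apply/eqP/negPn/negP => ps; apply: Yx; exists s.
have invY : invariant_set sigma Y by move=> s x Yx t; rewrite -tactM.
have Y0 : Y = set0.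
  case: (mini Y clY invY) => // YT; exfalso; apply: px0.
  by have : Y x0 by [rewrite YT]; move=> /(_ 1%g); rewrite tact1.
have [D DX] : exists D : {fset G}, forall x, exists2 s, s \in D & p (sigma s x) != 0.
  have FF := @summability.totally_filter G.
  have : compact [set: X] by exact: compactHausdorff_compact.
  (* Compactness is used along the filter of finite subsets of [G] ordered by inclusion: each point
     has a neighbourhood served by every [D] containing a suitable [s], so one [D] serves all
     points. *)
  move=> /compact_near_coveringP /(_ _ (@summability.totally G)
    (fun (D : {fset G}) x => exists2 s, s \in D & p (sigma s x) != 0) _).
  case=> [x _|D _ /(_ D (fsubset_refl D)) DX]; last by exists D => x; exact: DX.
  have [s psx] : exists s, p (sigma s x) != 0.
    apply: contrapT => nx; have : Y x; last by rewrite Y0.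
    by move=> s; apply/eqP/negPn/negP => ps; apply: nx; exists s.
  exists ([set y | p (sigma s y) != 0], [set D | [fset s] `<=` D]%fset) => /=.
    split; last by exists [fset s]%fset.
    by apply: open_nbhs_nbhs; split=> //; exact: openp.
  by move=> [y D] /= [psy]; rewrite fsub1set => sD; exists s.
pose u := \sum_(s <- D) alpha sigma s^-1%g (realFun pc).
apply: (@ideal_unit I u) => // [|x].
- have [I0 ID IZ IM] := Iid.
  rewrite /u; apply: (big_ind (fun v => I (single 1%g v))).
  + rewrite (_ : single 1%g 0 = 0) //.
    by apply: ell1P => s /=; case: eqP.
  + move=> v v' Iv Iv'; rewrite (_ : single 1%g (v + v') = single 1%g v + single 1%g v').
      exact: ID.
    apply: ell1P => s.
    transitivity ((if s == 1%g then v else 0) + (if s == 1%g then v' else 0)) => //=.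
    by case: eqP; rewrite ?addr0.
  + move=> s _.
    (* Each translate stays in [I] because $\delta_{s^{-1}}(p\,\delta_e)\delta_s =
       \alpha_{s^{-1}}(p)\,\delta_e$. *)
    have [_] := IM _ (single s^-1%g 1) (IM _ (single s 1) Ip).1.
    rewrite !single_mul_single mul1g mulVg alpha1 mul1r.
    by rewrite mulr1.
- rewrite contFun_sumE /=.
  have -> : \sum_(s <- D) (p (sigma s^-1^-1%g x))%:C = (\sum_(s <- D) p (sigma s x))%:C.
    by rewrite rmorph_sum /=; apply: eq_bigr => s _; rewrite invgK.
  rewrite fmorph_eq0 psumr_neq0 //; apply/hasP.
  have [s sD psx] := DX x.
  by exists s => //; rewrite /= lt_def psx p0.
Qed.

(** * The closed ideal attached to a closed invariant set *)

Definition vanishing_ideal (Y : set X) : set (ell1 R G X) :=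
  [set f : ell1 R G X | forall s y, Y y -> f s y = 0].

(** For closed invariant [Y] this ideal is the kernel of restriction of coefficients from [X] to
    [Y]. A bump at a point off [Y] shows that it is nonzero, and the unit, equal to 1 at a point of
    [Y], shows that it is not everything. *)
Lemma vanishing_idealP (Y : set X) : closed Y -> invariant_set sigma Y ->
  Y <> set0 -> Y <> setT ->
  [/\ proper_two_sided_ideal sigma (vanishing_ideal Y), closed (vanishing_ideal Y) &
      self_adjoint sigma (vanishing_ideal Y)].
Proof.
move=> clY invY Yn0 YnT; pose I := vanishing_ideal Y.
have I0 : I 0 by [].
split.
- split; first split=> //.
  + move=> f g If Ig s y Yy; transitivity (f s y + g s y) => //.
    by rewrite If // Ig // addr0.
  + move=> a f If s y Yy; transitivity (a * f s y) => //.
    by rewrite If // mulr0.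
  + move=> f g If; split=> s y Yy.
      apply: sum_vanish => [|t]; first exact: conv_term_summable.
      by transitivity (f t y * alpha sigma t (g (t^-1 * s)%g) y) => //; rewrite If // mul0r.
    apply: sum_vanish => [|t]; first exact: conv_term_summable.
    (* In this product [f] is evaluated at the translate of [y] by [t^-1], which invariance keeps in
       [Y]. *)
    transitivity (g t y * f (t^-1 * s)%g (sigma t^-1%g y)) => //.
    by rewrite If ?mulr0 //; exact: invY.
  + move=> I00; apply: YnT; apply/seteqP; split=> // x _; apply: contrapT => nYx.
    have : nbhs x (~` Y) by apply: open_nbhs_nbhs; split=> //; exact: closed_openC.
    move=> /(@urysohn_bump R) [p [pc _ px p0]].
    have : [set 0] (single 1%g (realFun pc)).
      by rewrite -I00 => s y Yy /=; case: eqP => // _; rewrite /= p0.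
    move=> /(congr1 (fun f : ell1 R G X => f 1%g x)) /=.
    by rewrite eqxx /= px => /eqP; rewrite oner_eq0.
  + move=> IT; apply: Yn0; apply/seteqP; split=> // y Yy.
    have : vanishing_ideal Y (single 1%g 1) by rewrite IT.
    by move=> /(_ 1%g y Yy) /=; rewrite eqxx => /eqP; rewrite oner_eq0.
- move=> f If s y Yy; apply: ComplexField.Normc.eq0_normc; apply/eqP.
  rewrite eq_le normc_ge0 andbT; apply/ler_addgt0Pr => e e0; rewrite add0r.
  have /If : nbhs f (ball f e%:C) by apply: nbhsx_ballx; rewrite ltcR.
  move=> [g [Ig]]; rewrite -ball_normE /= ell1_normE ltcR => /ltW; apply: le_trans.
  apply: le_trans (supnorm_ell1norm _ s); apply: le_trans (normc_supnorm _ y).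
  by rewrite [X in _ <= normc X](_ : _ = f s y - g s y) // Ig // subr0.
- move=> f If s y Yy /=; rewrite If ?conjc0 //; exact: invY.
Qed.

End ideals.

(* The cycle of implications *)
Local Close Scope complex_scope.

Theorem theorem3p10 (R : realType) (G : groupType) (X : compactHausdorffType)
    (sigma : topAction G X)
    (G_countable : countable [set: G]) (G_infinite : infinite_set [set: G])
    (sigma_free : topologically_free sigma) :
  [<-> ~ (exists I : set (ell1 R G X), proper_two_sided_ideal sigma I /\ closed I);
       ~ (exists I : set (ell1 R G X),
            [/\ proper_two_sided_ideal sigma I, closed I & self_adjoint sigma I]);
       minimal_action sigma].
Proof.
tfae.
- by move=> noI [I [Ipr clI _]]; apply: noI; exists I.
- move=> noI Y clY invY; apply: contrapT => /not_orP[Y0 YT]; apply: noI.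
  by eexists; apply: vanishing_idealP clY invY Y0 YT.
- move=> mini [I [[Iid I0 IT] clI]].
  have [f If f0] : exists2 f, I f & f <> 0.
    apply: contra_notP I0 => nof; apply/seteqP; split=> [f If|_ ->].
      by apply: contrapT => f0; apply: nof; exists f.
    by case: Iid.
  have [p [pc [p0 px Ip]]] := ideal_bump sigma_free Iid clI If f0.
  exact/IT/(ideal_positive_full mini Iid p0 px Ip).
Qed.
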